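(* Let $S$ be a numerical semigroup, and let $I$ be a minimal element, with respect to inclusion, of $\mathcal{I}_0(S)\setminus\{S\}$. Then $I$ is a quark of $\mathcal{I}_0(S)$.
   Context: $\mathbb{N}$ denotes the non-negative integers. A numerical semigroup $S$ is a submonoid of $(\mathbb{N},+)$ with finite complement in $\mathbb{N}$. $\mathcal{I}_0(S)=\{E\subseteq\mathbb{N}: E+S\subseteq E,\ \min(E)=0\}$ is the set of ideals of $S$ with minimum $0$; it is a commutative monoid under $I+J=\{a+b: a\in I, b\in J\}$, with identity $S$ (the ''zero'' ideal of this monoid), and $S$ is its only unit. For $I,J\in\mathcal{I}_0(S)$, $I\preceq J$ means $J=I+K$ for some $K\in\mathcal{I}_0(S)$, and $I\prec J$ means $I\preceq J$ and $J\not\preceq I$ (equivalently, $I\preceq J$ and $I\ne J$). A non-unit $Q$ (that is, $Q\neq S$) is a quark if there is no non-unit $J$ with $J\prec Q$. *)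

(* Defs.v *)
From mathcomp Require Import all_boot all_order.
From mathcomp Require Import classical_sets cardinality.

Set Implicit Arguments.
Unset Strict Implicit.
Unset Printing Implicit Defensive.

Local Open Scope classical_set_scope.

Definition setadd (A B : set nat) : set nat := [set a + b | a in A & b in B].

Definition numerical_semigroup (S : set nat) : Prop :=
  [/\ S 0, (forall a b, S a -> S b -> S (a + b)) & finite_set (~` S)].

Definition is_min (E : set nat) (m : nat) : Prop := E m /\ lbound E m.

(* ideals0 S is the carrier I_0(S) of the monoid whose law is setadd and whose
   identity is S. *)
Definition ideals0 (S : set nat) : set (set nat) :=
  [set E | setadd E S `<=` E /\ is_min E 0].

Definition ideal_unit (S I : set nat) : Prop :=
  ideals0 S I /\ exists2 J, ideals0 S J & setadd I J = S.

Definition ideal_le (S I J : set nat) : Prop :=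
  exists2 K, ideals0 S K & J = setadd I K.

Definition ideal_lt (S I J : set nat) : Prop :=
  ideal_le S I J /\ ~ ideal_le S J I.

Definition quark (S Q : set nat) : Prop :=
  [/\ ideals0 S Q, ~ ideal_unit S Q &
      ~ exists J, [/\ ideals0 S J, ~ ideal_unit S J & ideal_lt S J Q]].

Definition minimal_for_inclusion (F : set (set nat)) (I : set nat) : Prop :=
  F I /\ forall J, F J -> J `<=` I -> J = I.

(* Main.v *)
(** Every ideal [E] with minimum [0] absorbs [S] ([E + S = E]) and contains
    [S]. Hence [I + J = S] forces [I = S], and [S] is the only unit. If [J] is a
    non-unit with [I = J + K], then [0 \in K] gives [J `<=` I], so [J = I] by
    minimality and [J] is not strictly below [I]. *)

Require Import Defs.
From mathcomp Require Import all_boot all_order.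
From mathcomp Require Import classical_sets cardinality.

Local Open Scope classical_set_scope.

Lemma setadd_subl (A B : set nat) : B 0 -> A `<=` setadd A B.
Proof. by move=> B0 a Aa; exists a => //; exists 0 => //; rewrite addn0. Qed.

Lemma setadd_subr (A B : set nat) : A 0 -> B `<=` setadd A B.
Proof. by move=> A0 b Bb; exists 0 => //; exists b. Qed.

Lemma ideals0_refl (S : set nat) : numerical_semigroup S -> ideals0 S S.
Proof.
move=> [S0 SD _]; split; last by split.
by move=> _ [a Sa] [b Sb] <-; exact: SD.
Qed.

Lemma setadd_idealr (S E : set nat) :
  numerical_semigroup S -> ideals0 S E -> setadd E S = E.
Proof.
by move=> [S0 _ _] [ES _]; apply/seteqP; split=> //; exact: setadd_subl.
Qed.

Lemma ideal_unitP (S I : set nat) :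
  numerical_semigroup S -> ideal_unit S I <-> I = S.
Proof.
move=> hS; split=> [[[IS [I0 _]] [J [_ [J0 _]] IJ]]|->].
(* Since [0] lies in [J], [I] sits inside [I + J = S]; since [0] lies in [I], [S] sits inside
   [I + S], hence inside [I]. *)
- apply/seteqP; split; first by rewrite -IJ; exact: setadd_subl.
  exact: subset_trans (setadd_subr _ _ I0) IS.
- have SS := ideals0_refl _ hS.
  by split=> //; exists S => //; exact: setadd_idealr.
Qed.

Theorem lemma5p10 (S : set nat) (hS : numerical_semigroup S) (I : set nat)
  (hI : minimal_for_inclusion (ideals0 S `\ S) I) : quark S I.
Proof.
have [[idI IneS] minI] := hI.
split=> //; first by move=> /(ideal_unitP _ _ hS).
move=> [J [idJ nuJ [[K [_ [K0 _]] IJK] nIJ]]].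
have JI : J = I.
  apply: minI; last by rewrite IJK; exact: setadd_subl.
  (* Minimality applies to [J] because a non-unit differs from [S]. *)
  by split=> // /(ideal_unitP _ _ hS).
(* With [J = I], strictness contradicts reflexivity of [ideal_le], whose witness is the identity:
   [I = I + S]. *)
apply: nIJ; rewrite JI; exists S; first exact: ideals0_refl.
by rewrite setadd_idealr.
Qed.
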